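(* Let $Z$ be a non-empty set, $F$ a correspondence from $Z$ to $Z$ with non-empty values, and $r$ a mapping from $Z$ to $[0,1]$. Assume that the set $\mathbf{V}=\{v_n : n\geq 1\}$, endowed with the uniform distance, is a precompact metric space. Then for every initial state $z$ in $Z$, the problem $\Gamma(z)=(Z,F,r,z)$ has a limit value, which is $$v^*(z)=\inf_{n\geq 1}\sup_{m\geq 0}v_{m,n}(z)=\sup_{m\geq 0}\inf_{n\geq 1}v_{m,n}(z).$$ Moreover, the sequence of functions $(v_n)_{n\geq1}$ converges uniformly on $Z$ to $v^*$.
   Context: A correspondence $F$ from $Z$ to $Z$ assigns to each $z\in Z$ a subset $F(z)\subseteq Z$. For $z_0\in Z$, a play at $z_0$ is a sequence $s=(z_1,z_2,\dots)\in Z^\infty$ with $z_t\in F(z_{t-1})$ for all $t\geq 1$; $S(z_0)$ is the set of plays at $z_0$. For a play $s=(z_t)_{t\geq 1}$, $m\geq 0$, $n\geq 1$: $\gamma_{m,n}(s)=\frac1n\sum_{t=1}^n r(z_{m+t})$ and $\gamma_n(s)=\gamma_{0,n}(s)$. For $z\in Z$: $v_{m,n}(z)=\sup_{s\in S(z)}\gamma_{m,n}(s)$ and $v_n(z)=v_{0,n}(z)=\sup_{s\in S(z)}\gamma_n(s)$. $v^*(z)$ is defined as $\inf_{n\geq1}\sup_{m\geq0}v_{m,n}(z)$. $\Gamma(z)$ has a limit value if $\liminf_n v_n(z)=\limsup_n v_n(z)$; the limit value is this common number. The uniform distance between bounded functions on $Z$ is $d_\infty(f,g)=\sup_{z\in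 Z}|f(z)-g(z)|$. Precompact means totally bounded: for every $\varepsilon>0$ the space is covered by finitely many balls of radius $\varepsilon$. *)

(* Defs.v *)
From HB Require Import structures.
From mathcomp Require Import all_boot all_order all_algebra.
From mathcomp Require Import all_classical all_reals all_analysis.
Import Order.TTheory GRing.Theory Num.Theory.
Import numFieldNormedType.Exports.

Set Implicit Arguments.
Unset Strict Implicit.
Unset Printing Implicit Defensive.

Local Open Scope classical_set_scope.
Local Open Scope ring_scope.

Section DynamicProgramming.
Context {R : realType} {Z : Type}.
Implicit Types (F : Z -> set Z) (r : Z -> R) (z : Z) (s : nat -> Z).

(* The play (z_1, z_2, ...) at z0 is encoded with the extra entry s 0 = z0, so
   that s t is z_t for every t. *)
Definition plays F z0 : set (nat -> Z) :=
  [set s | s 0%N = z0 /\ forall t, (1 <= t)%N -> F (s t.-1) (s t)].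

Definition gamma r (m n : nat) s : R :=
  n%:R^-1 * \sum_(1 <= t < n.+1) r (s (m + t)%N).

(* Only n >= 1 is meaningful: the value for n = 0 is 0. When F has non-empty
   values and r takes values in [0,1], the suprema and infima here and below
   are those of non-empty subsets of [0,1], so that the totalized real-valued
   sup and inf are the genuine ones. *)
Definition value_from F r (m n : nat) z : R :=
  sup [set gamma r m n s | s in plays F z].

Definition value F r (n : nat) z : R := value_from F r 0%N n z.

Definition vstar F r z : R :=
  inf [set sup [set value_from F r m n z | m in [set: nat]]
      | n in [set n | (1 <= n)%N]].

Definition sup_inf_value F r z : R :=
  sup [set inf [set value_from F r m n z | n in [set n | (1 <= n)%N]]
      | m in [set: nat]].

(* The index n = 0 does not influence the inferior and superior limits. *)
Definition has_limit_value F r z : Prop :=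
  limn_inf (fun n => value F r n z) = limn_sup (fun n => value F r n z).

Definition limit_value F r z : R := limn_inf (fun n => value F r n z).

(* Meaningful for bounded functions, for Z non-empty. *)
Definition dinfty (f g : Z -> R) : R :=
  sup [set `|f z - g z| | z in [set: Z]].

(* Total boundedness of V as a metric space in its own right: the centres of
   the balls belong to V. The library's [precompact] means that the closure in
   the ambient space is compact, which is not the notion wanted here. *)
Definition totally_bounded_dinfty (V : set (Z -> R)) : Prop :=
  forall eps : R, 0 < eps ->
    exists A : set (Z -> R), [/\ finite_set A, A `<=` V &
      V `<=` \bigcup_(f in A) [set g | dinfty f g < eps]].

End DynamicProgramming.

(* Main.v *)
Require Import Defs.
From HB Require Import structures.
From mathcomp Require Import all_boot all_order all_algebra.
From mathcomp Require Import all_classical all_reals all_analysis.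
From mathcomp Require Import lra zify.
Import Order.TTheory GRing.Theory Num.Theory.
Import numFieldNormedType.Exports.

Set Implicit Arguments.
Unset Strict Implicit.
Unset Printing Implicit Defensive.

Local Open Scope classical_set_scope.
Local Open Scope ring_scope.

(** Fix [z] and write W n for sup_m v_{m,n}(z), so that v*(z) is inf_n W n.

    Cutting a play into consecutive blocks of length n shows that
    v_T(z) <= W n + n / T for all T ([value_le_sup_value]), hence
    limsup v_T(z) <= v*(z) without any compactness.

    Compactness gives the reverse inequality ([sup_value_le_value]). Up to e,
    every v_n is one of finitely many functions v_k, and each of the finitely
    many suprema W k is attained up to e at some m. Since v_{m,n} depends on v_n
    in a monotone and 1-Lipschitz way, there is a single bound M such that, for
    all n, W n is attained up to 3e at some m <= M. As deleting the first m
    stages changes an average of length n by at most m / n, this yields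
    W n <= v_n(z) + M / n + 3e, and therefore v*(z) <= liminf v_n(z).

    So (v_n) converges pointwise to v*, and a totally bounded sequence of
    functions that converges pointwise converges uniformly
    ([uniform_of_pointwise_net]).

    It remains to find, for each e, one delay m such that v_{m,n}(z) is at least
    v*(z) - e for all n at once. For n beyond some N, uniform convergence gives
    this for every m. For n < N, take a play whose T-stage average is nearly
    v*(z), with T large, and stop at the stage m where the partial sums of
    r - c are minimal, c being slightly below that average: from m on, every
    average up to stage T is at least c, and m is far enough from T to leave
    room for N stages ([exists_good_tail]). *)

(** * Bounds uniform over finitely many indices *)

Lemma exists_nat_le_mul (R : realType) (a e : R) : 0 < e ->
  exists N : nat, (1 <= N)%N /\ forall n, (N <= n)%N -> a <= n%:R * e.
Proof.
move=> e0; exists (Num.truncn (`|a| / e)).+1; split=> // n Nn.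
rewrite -ler_pdivrMr //; apply: (@le_trans _ _ (`|a| / e)).
  by rewrite ler_pM2r ?invr_gt0// ler_norm.
apply/ltW; apply: (lt_le_trans (truncnS_gt _)).
by rewrite ler_nat.
Qed.

Lemma eventually_forall_le (Q : nat -> nat -> Prop) (N : nat) :
  (forall k, (k <= N)%N -> exists n0, forall n, (n0 <= n)%N -> Q k n) ->
  exists n0, forall k n, (k <= N)%N -> (n0 <= n)%N -> Q k n.
Proof.
elim: N => [|N IH] hQ.
  have [n0 h0] := hQ 0%N (leqnn _).
  by exists n0 => k n; rewrite leqn0 => /eqP -> /h0.
have [k kN|n0 h0] := IH _; first by apply: hQ; exact: leqW.
have [n1 h1] := hQ N.+1 (leqnn _).
exists (maxn n0 n1) => k n.
rewrite geq_max leq_eqVlt => /predU1P[->|kN] /andP[nn0 nn1].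
  exact: h1.
exact: h0.
Qed.

Lemma finite_set_bounded_index (T : Type) (P : T -> nat -> Prop) (A : set T) :
  finite_set A -> (forall f, A f -> exists k, P f k) ->
  exists N, forall f, A f -> exists2 k, (k <= N)%N & P f k.
Proof.
move=> finA hA.
have [k hk] : {k : T -> nat & forall f, A f -> P f (k f)}.
  apply: (@choice _ _ (fun f n => A f -> P f n)) => f.
  have [/hA[n Pn]|nA] := pselect (A f); first by exists n.
  by exists 0%N.
have /finite_seqP[s ks] := finite_image k finA.
exists (\max_(i <- s) i) => f Af; exists (k f); last exact: hk.
apply: (@leq_bigmax_seq _ s xpredT id) => //.
have : (k @` A) (k f) by exists f.
by rewrite ks.
Qed.

(** Total boundedness of the family [u n], n >= 1, for the uniform distance, with
    the centres of the balls recorded by a bound [N0] on their indices. *)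
Definition index_net (R : realType) (Z : Type) (u : nat -> Z -> R) : Prop :=
  forall e : R, 0 < e -> exists N0 : nat, forall n, (1 <= n)%N ->
    exists2 k, (k <= N0)%N & forall z, `|u k z - u n z| <= e.

(** * Average payoffs and values *)

Section Plays.
Context (R : realType) (Z : Type) (F : Z -> set Z) (r : Z -> R).
Context (hF : forall z : Z, F z !=set0) (hr : forall z : Z, 0 <= r z <= 1).

Definition total (s : nat -> Z) (k : nat) : R := \sum_(1 <= t < k.+1) r (s t).

Lemma total0 s : total s 0 = 0.
Proof. by rewrite /total big_geq. Qed.

Lemma totalD s a b : total s a <= total s (a + b)%N <= total s a + b%:R.
Proof.
elim: b => [|b IH]; first by rewrite addn0 lexx addr0 lexx.
rewrite addnS {2 3}/total big_nat_recr//= -/(total s (a + b)) -natr1.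
have := hr (s (a + b).+1); move: IH.
by move=> /andP[? ?] /andP[? ?]; apply/andP; split; lra.
Qed.


Lemma gammaE m n s : gamma r m n s = n%:R^-1 * (total s (m + n) - total s m).
Proof.
congr (_ * _); elim: n => [|n IH]; first by rewrite big_geq// addn0 subrr.
by rewrite big_nat_recr//= IH addnS {3}/total big_nat_recr//= addrAC.
Qed.

Lemma gamma_bounds m n s : 0 <= gamma r m n s <= 1.
Proof.
rewrite gammaE; have [->|n0] := posnP n; first by rewrite invr0 mul0r lexx ler01.
have n0' : 0 < n%:R :> R by rewrite ltr0n.
have /andP[h1 h2] := totalD s m n.
by rewrite mulrC ler_pdivrMr// ler_pdivlMr// mul0r mul1r; apply/andP; split; lra.
Qed.

(** The sums over stages m+1..m+n and 1..n differ by the stages n+1..n+m on one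
    side and 1..m on the other, each contributing between 0 and m. *)
Lemma gamma_close m n s : (1 <= n)%N ->
  `|gamma r m n s - gamma r 0 n s| <= m%:R / n%:R.
Proof.
move=> n1; rewrite !gammaE add0n total0 subr0 -mulrBr mulrC normrM.
have n0' : 0 < n%:R^-1 :> R by rewrite invr_gt0 ltr0n.
rewrite [X in _ * X]gtr0_norm// ler_pM2r// ler_norml.
have /andP[h1 h2] := totalD s n m; have /andP[h3 h4] := totalD s 0 m.
by rewrite add0n total0 in h3 h4; rewrite addnC; apply/andP; split; lra.
Qed.

Lemma plays_nonempty z : plays F z !=set0.
Proof.
have [f hf] := choice hF.
exists (fun n => iter n f z); split=> // -[//|t] _ /=; exact: hf.
Qed.

Lemma plays_shift z s m : plays F z s -> plays F (s m) (fun t => s (m + t)%N).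
Proof.
move=> [_ hs]; split; first by rewrite addn0.
by move=> [//|t] _ /=; rewrite addnS; exact: (hs (m + t).+1).
Qed.

Lemma plays_splice z s m s' : plays F z s -> plays F (s m) s' ->
  exists2 s'', plays F z s'' & forall t, s'' (m + t)%N = s' t.
Proof.
move=> [s0 hs] [s'0 hs'].
exists (fun t => if (t <= m)%N then s t else s' (t - m)%N) => [|t]; last first.
  case: leqP; last by rewrite addKn.
  by rewrite -[X in (_ <= X)%N]addn0 leq_add2l leqn0 => /eqP ->; rewrite addn0.
split=> [//|[//|t] _ /=].
case: (leqP t.+1 m) => tm; first by rewrite (ltnW tm); exact: (hs t.+1).
rewrite subSn; last by lia.
case: leqP => [mt|mt]; last exact: (hs' (t - m).+1).
have -> : t = m by lia.
by rewrite subnn -s'0; exact: (hs' 1%N).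
Qed.

(** The payoffs after stage m are those of the problem restarted at [s m]; this
    and [plays_splice] reduce v_{m,n}(z) to the values v_n at the states
    reachable from z in m stages. *)
Lemma gamma_shift m n s : gamma r 0 n (fun t => s (m + t)%N) = gamma r m n s.
Proof. by []. Qed.

Lemma gamma_le_value_from m n z s : plays F z s ->
  gamma r m n s <= value_from F r m n z.
Proof.
move=> hs; apply: ub_le_sup; last by exists s.
by exists 1 => _ [s' _ <-]; have /andP[] := gamma_bounds m n s'.
Qed.

Lemma value_from_le m n z c : (forall s, plays F z s -> gamma r m n s <= c) ->
  value_from F r m n z <= c.
Proof.
move=> hc; apply: ge_sup; last by move=> _ [s hs <-]; exact: hc.
by have [s hs] := plays_nonempty z; exists (gamma r m n s), s.
Qed.

Lemma value_from_bounds m n z : 0 <= value_from F r m n z <= 1.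
Proof.
apply/andP; split.
  have [s hs] := plays_nonempty z.
  apply: le_trans (gamma_le_value_from m n hs).
  by have /andP[] := gamma_bounds m n s.
by apply: value_from_le => s _; have /andP[] := gamma_bounds m n s.
Qed.

Lemma value_le_value_from z s m n : plays F z s ->
  value F r n (s m) <= value_from F r m n z.
Proof.
move=> hs; apply: value_from_le => s' hs'.
have [s'' hs'' e] := plays_splice hs hs'.
apply: le_trans (gamma_le_value_from m n hs'').
by have -> : s' = (fun t => s'' (m + t)%N) by apply/funext.
Qed.

(** v_{m,n}(z) is the supremum of v_n over the states reachable in m stages, hence
    inherits uniform inequalities between values. *)
Lemma value_from_mono m n k c z :
  (forall z', value F r n z' <= value F r k z' + c) ->
  value_from F r m n z <= value_from F r m k z + c.
Proof.
move=> h; apply: value_from_le => s hs; rewrite -gamma_shift.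
apply: le_trans (gamma_le_value_from 0 n (plays_shift m hs)) _.
by apply: le_trans (h _) _; rewrite lerD2r; exact: value_le_value_from.
Qed.

Lemma value_from_close m n z : (1 <= n)%N ->
  `|value_from F r m n z - value F r n z| <= m%:R / n%:R.
Proof.
move=> n1; rewrite ler_distl; apply/andP; split.
  rewrite lerBlDr; apply: value_from_le => s hs.
  have := gamma_close m s n1; rewrite ler_distl => /andP[h _].
  by have := gamma_le_value_from m n hs; lra.
apply: value_from_le => s hs.
have := gamma_close m s n1; rewrite ler_distl => /andP[_ h].
by have := gamma_le_value_from 0 n hs; rewrite -/(value F r n z); lra.
Qed.

(** * Comparing v_n with sup_m v_{m,n} *)

Definition sup_value n z : R := sup [set value_from F r m n z | m in [set: nat]].

Lemma value_from_le_sup_value m n z : value_from F r m n z <= sup_value n z.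
Proof.
apply: ub_le_sup; last by exists m.
by exists 1 => _ [k _ <-]; have /andP[] := value_from_bounds k n z.
Qed.

Lemma sup_value_le n z c : (forall m, value_from F r m n z <= c) ->
  sup_value n z <= c.
Proof.
move=> h; apply: ge_sup; last by move=> _ [m _ <-].
by exists (value_from F r 0 n z), 0%N.
Qed.

Lemma sup_value_adherent n z e : 0 < e ->
  exists m, sup_value n z - e <= value_from F r m n z.
Proof.
move=> e0; have [|_ [m _ <-] /ltW] := @sup_adherent R
  [set value_from F r m n z | m in [set: nat]] e e0; last by exists m.
split; first by exists (value_from F r 0 n z), 0%N.
by exists 1 => _ [k _ <-]; have /andP[] := value_from_bounds k n z.
Qed.

Lemma sup_value_ge0 n z : 0 <= sup_value n z.
Proof.
apply: le_trans (value_from_le_sup_value 0 n z).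
by have /andP[] := value_from_bounds 0 n z.
Qed.

Lemma vstar_le_sup_value n z : (1 <= n)%N -> vstar F r z <= sup_value n z.
Proof.
move=> n1; apply: ge_inf; last by exists n.
by exists 0 => _ [k _ <-]; exact: sup_value_ge0.
Qed.

Lemma vstar_adherent z e : 0 < e ->
  exists2 n, (1 <= n)%N & sup_value n z <= vstar F r z + e.
Proof.
move=> e0.
have [|_ [n n1 <-] /ltW] := @inf_adherent R
  [set sup_value n z | n in [set n | (1 <= n)%N]] e e0; last by exists n.
split; first by exists (sup_value 1 z), 1%N.
by exists 0 => _ [k _ <-]; exact: sup_value_ge0.
Qed.

(** Remove one block of length n at a time; the last, incomplete block accounts
    for the additive n. *)
Lemma total_le_blocks n s w : (1 <= n)%N -> 0 <= w ->
  (forall m, gamma r m n s <= w) ->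
  forall T m, total s (m + T) - total s m <= T%:R * w + n%:R.
Proof.
move=> n1 w0 hw T; have [k] := ubnP T; elim: k T => // k IH T Tk m.
have [Tn|nT] := leqP T n.
  have /andP[_ h] := totalD s m T.
  have : T%:R <= n%:R :> R by rewrite ler_nat.
  by have := mulr_ge0 (ler0n R T) w0; lra.
have := IH (T - n)%N _ (m + n)%N; rewrite -addnA subnKC; last exact: ltnW.
rewrite natrB; last exact: ltnW.
move=> /(_ ltac:(lia)) h.
have n0' : 0 < n%:R :> R by rewrite ltr0n.
have := hw m; rewrite gammaE mulrC ler_pdivrMr// => h'.
by nra.
Qed.

Lemma value_le_sup_value n T z : (1 <= n)%N -> (1 <= T)%N ->
  value F r T z <= sup_value n z + n%:R / T%:R.
Proof.
move=> n1 T1; apply: value_from_le => s hs.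
have T0 : 0 < T%:R :> R by rewrite ltr0n.
rewrite gammaE mulrC ler_pdivrMr// mulrDl divfK ?gt_eqF// mulrC.
apply: total_le_blocks (sup_value_ge0 n z) _ _ _ => // m.
exact: le_trans (gamma_le_value_from m n hs) (value_from_le_sup_value m n z).
Qed.

(** [M] bounds the delays m at which the finitely many suprema
    [sup_value k z], k <= N0, are attained up to e; one e is lost there and two
    more in passing from n to a nearby index k and back. *)
Lemma sup_value_le_value (z : Z) (e : R) (N0 : nat) : 0 < e ->
  (forall n, (1 <= n)%N -> exists2 k, (k <= N0)%N &
     forall z', `|value F r k z' - value F r n z'| <= e) ->
  exists M : nat, forall n, (1 <= n)%N ->
    sup_value n z <= value F r n z + M%:R / n%:R + 3 * e.
Proof.
move=> e0 net.
have [M hM] : exists M : nat, forall k M', (k <= N0)%N -> (M <= M')%N ->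
    exists2 m, (m <= M')%N & sup_value k z - e <= value_from F r m k z.
  apply: eventually_forall_le => k _.
  have [m hm] := sup_value_adherent k z e0.
  by exists m => n mn; exists m.
exists M => n n1; have [k kN hk] := net n n1.
have [m mM hm] := hM k M kN (leqnn _).
have h1 : sup_value n z <= sup_value k z + e.
  apply: sup_value_le => m'.
  apply: le_trans (_ : value_from F r m' k z + e <= _); last first.
    by rewrite lerD2r; exact: value_from_le_sup_value.
  apply: value_from_mono => z'.
  by have := hk z'; rewrite ler_distl => /andP[]; lra.
have h2 : value_from F r m k z <= value_from F r m n z + e.
  apply: value_from_mono => z'.
  by have := hk z'; rewrite ler_distl => /andP[]; lra.
have h3 : m%:R / n%:R <= M%:R / n%:R :> R.
  by rewrite ler_pM2r ?invr_gt0 ?ltr0n// ler_nat.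
by have := value_from_close m z n1; rewrite ler_distl => /andP[]; lra.
Qed.

End Plays.

(** * Convergence *)

Section UniformConvergence.
Context (R : realType) (Z : Type) (u : nat -> Z -> R) (l : Z -> R).
Context (ul : forall z e, 0 < e ->
  exists n0, forall n, (n0 <= n)%N -> `|u n z - l z| <= e).

(** A ball of the net that contains infinitely many [u n] has its centre close to
    the pointwise limit, so all its members are; past some index only such balls
    are visited. *)
Lemma uniform_of_pointwise_net : index_net u ->
  forall e : R, 0 < e ->
    exists n0, forall n, (n0 <= n)%N -> forall z, `|u n z - l z| <= e.
Proof.
move=> net e e0; have e3 : 0 < e / 3 by lra.
have [N0 hN0] := net _ e3.
pose near_k k n := forall z, `|u k z - u n z| <= e / 3.
have [n0 hn0] : exists n0, forall k n, (k <= N0)%N -> (n0 <= n)%N ->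
    near_k k n -> forall n1, exists2 n', (n1 <= n')%N & near_k k n'.
  apply: eventually_forall_le => k _.
  have [io|nio] := pselect (forall n1, exists2 n', (n1 <= n')%N & near_k k n').
    by exists 0%N.
  move/existsNP: nio => [n1 hn1]; exists n1 => n n1n nk; exfalso.
  by apply: hn1; exists n.
exists (maxn n0 1) => n; rewrite geq_max => /andP[nn0 n1] z.
have [k kN nk] := hN0 n n1.
have near_io := hn0 k n kN nn0 nk.
have [n2 hn2] := ul z e3.
have [n' n2n' nk'] := near_io n2.
have := hn2 n' n2n'; have := nk z; have := nk' z.
rewrite !ler_distl => /andP[? ?] /andP[? ?] /andP[? ?].
by apply/andP; split; lra.
Qed.
End UniformConvergence.

Section Limit.
Context (R : realType) (Z : Type) (F : Z -> set Z) (r : Z -> R).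
Context (hF : forall z : Z, F z !=set0) (hr : forall z : Z, 0 <= r z <= 1).

Lemma value_cvg_vstar : index_net (value F r) ->
  forall z (e : R), 0 < e ->
    exists n0, forall n, (n0 <= n)%N -> `|value F r n z - vstar F r z| <= e.
Proof.
move=> net z e e0.
have e2 : 0 < e / 2 by lra.
have e4 : 0 < e / 4 by lra.
have [n n1 hn] := vstar_adherent hF hr z e2.
have [N0 hN0] := net _ e4.
have [M hM] := sup_value_le_value hF hr z e4 hN0.
have [A [A1 hA]] := exists_nat_le_mul n%:R e2.
have [B [B1 hB]] := exists_nat_le_mul M%:R e4.
exists (maxn A B) => T; rewrite geq_max => /andP[AT BT].
have T1 : (1 <= T)%N by lia.
have T0 : 0 < T%:R :> R by rewrite ltr0n.
have h1 := value_le_sup_value hF hr z n1 T1.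
have h2 := hM T T1.
have h3 := vstar_le_sup_value hF hr z T1.
have h4 : n%:R / T%:R <= e / 2 by rewrite ler_pdivrMr// mulrC hA.
have h5 : M%:R / T%:R <= e / 4 by rewrite ler_pdivrMr// mulrC hB.
by rewrite ler_distl; apply/andP; split; lra.
Qed.

(** Take for m a minimiser over [0, T] of the partial sums of r - c: increments
    from m on are nonnegative. The partial sum is at most 0 at m and at least
    T * d at T, while each stage adds at most 1 - c, which bounds T - m below. *)
Lemma exists_good_tail (s : nat -> Z) (c d : R) (T : nat) : c < 1 ->
  T%:R * (c + d) <= total r s T ->
  exists m : nat, T%:R * d <= (T%:R - m%:R) * (1 - c) /\
    forall n, (1 <= n)%N -> (m + n <= T)%N -> c <= gamma r m n s.
Proof.
move=> c1 hT.
pose f k := total r s k - k%:R * c.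
have [m _ hm] := @arg_minP _ _ _ (@ord0 T) xpredT (fun k : 'I_T.+1 => f k) isT.
have {}hm k : (k <= T)%N -> f m <= f k.
  by move=> kT; have := hm (Ordinal (kT : (k < T.+1)%N)) isT.
have mT : (m <= T)%N by rewrite -ltnS.
exists m; split.
  have := hm 0%N isT; rewrite /f total0 mul0r subr0 => hm0.
  have /andP[_] := totalD hr s m (T - m); rewrite subnKC// natrB// => h.
  by nra.
move=> n n1 mnT; rewrite gammaE mulrC ler_pdivlMr ?ltr0n//.
by have := hm _ mnT; rewrite /f natrD; lra.
Qed.

Lemma sup_inf_value_le_vstar z : sup_inf_value F r z <= vstar F r z.
Proof.
apply: ge_sup.
  by exists (inf [set value_from F r 0 n z | n in [set n | (1 <= n)%N]]), 0%N.
move=> _ [m _ <-]; apply: lb_le_inf; first by exists (sup_value F r 1 z), 1%N.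
move=> _ [n n1 <-]; apply: le_trans (value_from_le_sup_value hF hr m n z).
apply: ge_inf; last by exists n.
by exists 0 => _ [k _ <-]; have /andP[] := value_from_bounds hF hr m k z.
Qed.

Lemma le_sup_inf_value m z c :
  (forall n, (1 <= n)%N -> c <= value_from F r m n z) ->
  c <= sup_inf_value F r z.
Proof.
move=> h; apply: (@le_trans _ _
  (inf [set value_from F r m n z | n in [set n | (1 <= n)%N]])).
  apply: lb_le_inf; first by exists (value_from F r m 1 z), 1%N.
  by move=> _ [n n1 <-]; exact: h.
apply: ub_le_sup; last by exists m.
exists 1 => _ [k _ <-].
apply: (@le_trans _ _ (value_from F r k 1 z)).
  apply: ge_inf; last by exists 1%N.
  by exists 0 => _ [j _ <-]; have /andP[] := value_from_bounds hF hr k j z.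
by have /andP[] := value_from_bounds hF hr k 1 z.
Qed.

(** Uniformity is used for horizons n >= N: it makes the bound on v_{m,n}(z) hold
    for every delay m, so that m can be chosen to suit the horizons n < N. *)
Lemma vstar_le_sup_inf_value :
  (forall e : R, 0 < e -> exists n0, forall n, (n0 <= n)%N ->
     forall z, `|value F r n z - vstar F r z| <= e) ->
  forall z, vstar F r z <= sup_inf_value F r z.
Proof.
move=> unif z; apply/ler_addgt0Pl => e' e'0.
pose e := e' / 4; have e0 : 0 < e by rewrite /e; lra.
have [N hN] := unif _ e0.
(* v_{m,n}(z) is compared with v_{m,K}(z) for K so large that the delay m no
   longer matters. *)
have large m n : (1 <= n)%N -> (N <= n)%N ->
    vstar F r z - 4 * e <= value_from F r m n z.
  move=> n1 Nn.
  have [B [B1 hB]] := exists_nat_le_mul m%:R e0.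
  pose K := maxn B N.
  have K1 : (1 <= K)%N by rewrite /K; lia.
  have h1 : value_from F r m K z <= value_from F r m n z + 2 * e.
    apply: value_from_mono => // z'.
    have := hN n Nn z'; have := hN K (leq_maxr _ _) z'.
    by rewrite !ler_distl => /andP[? ?] /andP[? ?]; lra.
  have h2 : m%:R / K%:R <= e.
    by rewrite ler_pdivrMr ?ltr0n// mulrC hB// leq_maxl.
  have := value_from_close hF hr m z K1; have := hN K (leq_maxr _ _) z.
  by rewrite !ler_distl => /andP[? ?] /andP[? ?]; lra.
pose c := vstar F r z - 3 * e.
have v1 : vstar F r z <= 1.
  apply: le_trans (vstar_le_sup_value hF hr z (leqnn 1)) _.
  by apply: sup_value_le => m; have /andP[] := value_from_bounds hF hr m 1 z.
have c1 : c < 1 by rewrite /c; lra.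
(* This makes T * e >= N * (1 - c), so that the stage m given by
   [exists_good_tail] satisfies m + N <= T. *)
have [T0 [T1 hT]] := exists_nat_le_mul (N%:R * (1 - c)) e0.
pose T := maxn T0 N.
have T1' : (1 <= T)%N by rewrite /T; lia.
have [_ [s hs <-] gs] : exists2 g, [set gamma r 0 T s | s in plays F z] g &
    value F r T z - e < g.
  apply: sup_adherent => //; split.
    by have [s hs] := plays_nonempty hF z; exists (gamma r 0 T s), s.
  by exists 1 => _ [s _ <-]; have /andP[] := gamma_bounds hr 0 T s.
have hsT : T%:R * (c + e) <= total r s T.
  have := hN T (leq_maxr _ _) z; rewrite ler_distl => /andP[hv _].
  have : c + e <= gamma r 0 T s by rewrite /c; lra.
  by rewrite gammaE add0n total0 subr0 mulrC ler_pdivlMr ?ltr0n// mulrC.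
have [m [mT hm]] := exists_good_tail c1 hsT.
have NmT : (m + N <= T)%N.
  have : N%:R * (1 - c) <= (T%:R - m%:R) * (1 - c).
    by apply: le_trans mT; apply: hT; exact: leq_maxl.
  by rewrite ler_pM2r ?subr_gt0// -(ler_nat R) natrD; lra.
rewrite -lerBlDl; apply: (@le_sup_inf_value m) => n n1.
have -> : e' = 4 * e by rewrite /e; lra.
have [Nn|nN] := leqP N n; first exact: large.
apply: le_trans (gamma_le_value_from hr m n hs).
apply: le_trans (hm n n1 _); first by rewrite /c; lra.
by lia.
Qed.

Lemma totally_bounded_value_net : inhabited Z ->
  totally_bounded_dinfty [set value F r n | n in [set n | (1 <= n)%N]] ->
  index_net (value F r).
Proof.
move=> [z0] hV e e0; have [A [finA AV VA]] := hV e e0.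
have [|N hN] := @finite_set_bounded_index _ (fun f k => value F r k = f) A finA.
  by move=> f /AV[k _ <-]; exists k.
exists N => n n1; have [|f Af /= fn] := VA (value F r n); first by exists n.
have [k kN kf] := hN f Af; exists k => // z.
apply: le_trans (ltW fn); rewrite -kf; apply: ub_le_sup; last by exists z.
exists 1 => _ [z' _ <-]; rewrite ler_distl.
have := value_from_bounds hF hr 0 k z'; have := value_from_bounds hF hr 0 n z'.
by rewrite -!/(value _ _ _ _) => /andP[? ?] /andP[? ?]; apply/andP; split; lra.
Qed.
End Limit.

Theorem theorem3p10 (R : realType) (Z : Type) (hZ : inhabited Z)
  (F : Z -> set Z) (hF : forall z : Z, F z !=set0)
  (r : Z -> R) (hr : forall z : Z, 0 <= r z <= 1)
  (hV : totally_bounded_dinfty [set value F r n | n in [set n | (1 <= n)%N]]) :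
  (forall z : Z,
     [/\ has_limit_value F r z,
         limit_value F r z = vstar F r z &
         vstar F r z = sup_inf_value F r z]) /\
  {uniform, value F r @ \oo --> (vstar F r : {classic Z} -> R)}.
Proof.
have net := totally_bounded_value_net hF hr hZ hV.
have pw := value_cvg_vstar hF hr net.
have unif := uniform_of_pointwise_net pw net.
split=> [z|].
  have cv : (value F r ^~ z) @ \oo --> vstar F r z.
    apply/cvgrPdist_le => e e0; have [n0 hn0] := pw z e e0.
    by exists n0 => // n /= /hn0; rewrite distrC.
  have [li ls] := cvg_limn_inf_sup cv.
  split; [by rewrite /has_limit_value li ls | exact: li |].
  apply/eqP; rewrite eq_le sup_inf_value_le_vstar// andbT.
  exact: vstar_le_sup_inf_value.
move=> P /uniform_nbhs[E [/= entE EP]].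
move: entE; rewrite -entourage_ballE => -[/= e e0 eE].
have e2 : 0 < e / 2 by rewrite /= in e0; lra.
have [n0 hn0] := unif _ e2.
exists n0 => // n /= n0n; apply: EP => z _; apply: eE => /=.
rewrite -ball_normE /= distrC; apply: le_lt_trans (hn0 n n0n z) _.
by rewrite /= in e0; lra.
Qed.
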